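(* If $G$ is a finite transitive imprimitive permutation group of degree $n$, then $|G:D(G)|\leqslant\sqrt{n}-1$. Moreover, if $n$ is an even power of a prime (that is, $n=p^{2a}$ with $p$ prime and $a\geqslant1$), then there exists a transitive imprimitive permutation group $G$ of degree $n$ with $|G:D(G)|=\sqrt{n}-1$.
   Context: For a finite permutation group $G$, $D(G)$ denotes the subgroup of $G$ generated by the derangements in $G$, i.e. the elements with no fixed points. A transitive group is imprimitive if it preserves a partition of the set acted on into blocks of equal size $k$ with $1<k<n$. *)

(* Defs.v *)
From mathcomp Require Import all_boot all_order all_algebra all_fingroup.

Set Implicit Arguments.
Unset Strict Implicit.
Unset Printing Implicit Defensive.

Local Open Scope group_scope.

(* Finite permutation groups on a finite set T are the G : {group {perm T}}, of
   degree #|T|; 'P is the natural action of {perm T} on T. *)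

Definition derangements (T : finType) (G : {set {perm T}}) : {set {perm T}} :=
  [set g in G | [forall x, g x != x]].

Definition derangement_subgroup (T : finType) (G : {set {perm T}}) :
    {set {perm T}} :=
  <<derangements G>>.

(* ('P)^* is the induced action on subsets of T, so that the second conjunct
   says that every element of G maps blocks to blocks. *)
Definition block_system (T : finType) (G : {set {perm T}}) (k : nat)
    (Q : {set {set T}}) : Prop :=
  [/\ partition Q [set: T],
      [acts G, on Q | ('P)^*] &
      forall B : {set T}, B \in Q -> #|B| = k].

Definition transitive_imprimitive (T : finType) (G : {set {perm T}}) : Prop :=
  [transitive G, on [set: T] | 'P] /\
  exists (k : nat) (Q : {set {set T}}), 1 < k < #|T| /\ block_system G k Q.

(* Main.v *)
(* Let D = D(G). The fixed-point counts of a transitive group G sum to |G| over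
   G, and to r|D| over D, where r is the number of D-orbits. Elements outside D
   fix at least one point, so r|D| <= |D|: hence D is transitive and every
   element outside D fixes exactly one point. The stabiliser in G_x of a second
   point therefore lies in D_x, and |G : D| = |G_x : D_x| is at most the length
   of any nontrivial orbit of G_x. This applies to the points and also to the
   blocks, since an element fixing a point fixes its block: for blocks of size k
   it bounds |G : D| by both k - 1 and n/k - 1, one of which is at most
   sqrt n - 1.
   Equality is attained by the maps v |-> l v + w of F x F, where F is the field
   of order p^a and l <> 0: such a map with l <> 1 fixes a point, so D consists
   of translations and the p^a - 1 homotheties lie in distinct cosets of D. *)

Require Import Defs.
From mathcomp Require Import all_boot all_order all_algebra all_fingroup.
From mathcomp Require Import finfield.

Set Implicit Arguments.
Unset Strict Implicit.
Unset Printing Implicit Defensive.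

Import Order.TTheory GRing.Theory Num.Theory.

(** * Fixed-point counting relative to a subgroup *)

Section FixedPointsOutside.

Local Open Scope group_scope.

Variables (aT : finGroupType) (rT : finType) (to : {action aT &-> rT}).
Variables (G D : {group aT}) (S : {set rT}).
Hypotheses (sDG : D \subset G) (trG : [transitive G, on S | to]).
Hypothesis fixGD : {in G :\: D, forall g, 0 < #|'Fix_(S | to)[g]|}.

Let actsG : [acts G, on S | to] := atrans_acts trG.

(** Orbit counting is applied to [G] and to [D]: [G] has a single orbit, and its sum splits over [D]
    and [G :\: D]. *)
Lemma sum_Fix_setD :
  #|orbit to D @: S| * #|D| + \sum_(g in G :\: D) #|'Fix_(S | to)[g]| = #|G|.
Proof.
rewrite -(Frobenius_Cauchy (subset_trans sDG actsG)).
have := Frobenius_Cauchy actsG.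
rewrite (big_setID D) /= (setIidPr sDG) => ->.
suff -> : [set orbit to G x | x in S] = [set S] by rewrite cards1 mul1n.
have /imsetP[x Sx defS] := trG.
apply/setP=> X; rewrite inE; apply/imsetP/eqP=> [[y Sy ->]|->].
  exact: (atransP trG).
by exists x.
Qed.

Lemma ltn_sum_Fix_setD g : g \in G :\: D -> 1 < #|'Fix_(S | to)[g]| ->
  #|G :\: D| < \sum_(h in G :\: D) #|'Fix_(S | to)[h]|.
Proof.
move=> GDg fix2; rewrite -sum1_card !(bigD1 g GDg) /= -addSn leq_add //.
by apply: leq_sum => h /andP[/fixGD].
Qed.

Lemma orbits_subgroup_eq1 : #|orbit to D @: S| = 1%N.
Proof.
have /imsetP[x Sx _] := trG.
apply/eqP; rewrite eqn_leq; apply/andP; split; last first.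
  by apply/card_gt0P; exists (orbit to D x); apply: imset_f.
rewrite -(leq_pmul2r (cardG_gt0 D)) mul1n.
have cGD : #|D| + #|G :\: D| = #|G| by rewrite -(cardsID D G) (setIidPr sDG).
rewrite -(leq_add2r #|G :\: D|) cGD -sum_Fix_setD leq_add2l -sum1_card.
by apply: leq_sum => h /fixGD.
Qed.

Lemma atrans_subgroup : [transitive D, on S | to].
Proof.
have [O defO] := cards1P (introT eqP orbits_subgroup_eq1).
have /and3P[/eqP <- _ _] := orbit_partition (subset_trans sDG actsG).
rewrite defO /cover big_set1.
have /imsetP[x _ ->] : O \in orbit to D @: S by rewrite defO set11.
exact: atrans_orbit.
Qed.

(** With one [D]-orbit, the counting identity makes the sum over [G :\: D] equal to [#|G :\: D|]; a
    second fixed point would make it larger. *)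
Lemma Fix_outside_le1 g : g \in G :\: D -> #|'Fix_(S | to)[g]| <= 1.
Proof.
move=> GDg; rewrite leqNgt; apply/negP=> /(ltn_sum_Fix_setD GDg).
rewrite -(ltn_add2l #|D|) -{2}[#|D|]mul1n -orbits_subgroup_eq1 sum_Fix_setD.
by rewrite -(cardsID D G) (setIidPr sDG) ltnn.
Qed.

(** The orbit length is the index in [G_x] of the stabiliser of [y], a subgroup of [D_x]. The action
    is arbitrary so that points and blocks are both covered. *)
Lemma index_le_suborbit x y : x \in S -> y \in S -> y != x ->
  #|G : D| <= #|orbit to 'C_G[x | to] y|.
Proof.
move=> Sx Sy neq_yx; rewrite card_orbit.
have sCD : 'C_('C_G[x | to])[y | to] \subset 'C_D[x | to].
  apply/subsetP=> g /setIP[/setIP[Gg cx] cy]; rewrite inE cx andbT.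
  apply/idPn=> D'g; have /Fix_outside_le1: g \in G :\: D by rewrite inE D'g.
  apply/negP; rewrite -ltnNge.
  have <- : #|[set y; x]| = 2 by rewrite cards2 neq_yx.
  apply/subset_leq_card/subsetP=> z /set2P[] ->; apply/setIP; split=> //.
    by apply/afix1P; apply: (astab1P cy).
  by apply/afix1P; apply: (astab1P cx).
(* [G] and [D] are both transitive on [S], so passing to stabilisers divides both orders by
   [#|S|]. *)
have -> : #|G : D| = #|'C_G[x | to] : 'C_D[x | to]|.
  apply/eqP; rewrite -(eqn_pmul2l (cardG_gt0 'C_D[x | to])).
  rewrite Lagrange ?setSI //.
  have Spos : 0 < #|S| by apply/card_gt0P; exists x.
  rewrite -(eqn_pmul2l Spos) mulnA.
  rewrite -{1}(atransP atrans_subgroup x Sx) card_orbit_stab Lagrange //.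
  by rewrite -(atransP trG x Sx) card_orbit_stab.
by rewrite dvdn_leq ?indexgS // indexg_gt0.
Qed.

End FixedPointsOutside.

(** * Upper bounds from a block system *)

Section BlockSystem.

Local Open Scope group_scope.

Variables (T : finType) (G : {group {perm T}}) (k : nat) (Q : {set {set T}}).
Hypotheses (trG : [transitive G, on [set: T] | 'P]).
Hypothesis blockQ : block_system G k Q.

Let partQ : partition Q [set: T]. Proof. by case: blockQ. Qed.
Let tiQ : trivIset Q. Proof. by case/and3P: partQ. Qed.
Let coverQ x : x \in cover Q. Proof. by rewrite (cover_partition partQ) inE. Qed.

Lemma block_image g B : g \in G -> B \in Q -> ('P^* B g)%act \in Q.
Proof. by case: blockQ => _ /actsP actQ _ Gg; rewrite actQ. Qed.

Lemma pblock_image g x : g \in G ->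
  ('P^* (pblock Q x) g)%act = pblock Q (g x).
Proof.
move=> Gg; apply/esym/def_pblock=> //; first exact/block_image/pblock_mem.
by rewrite -[g x]apermE (mem_setact 'P) ?mem_pblock.
Qed.

Lemma block_transitive : 0 < #|T| -> [transitive G, on Q | 'P^*].
Proof.
case/card_gt0P=> x _; apply/imsetP; exists (pblock Q x); first exact: pblock_mem.
apply/setP=> B; apply/idP/orbitP=> [QB | [g Gg <-]]; last first.
  exact/block_image/pblock_mem.
have /set0Pn[y By] : B != set0.
  by case/and3P: partQ => _ _; apply: contraNneq => <-.
have /orbitP[g Gg /= gx] : y \in orbit 'P G x by rewrite (atransP trG) ?inE.
exists g => //; rewrite pblock_image //.
by rewrite apermE in gx; rewrite gx (def_pblock tiQ QB).
Qed.

Lemma derangement_subgroup_sub : <<derangements G>> \subset G.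
Proof. by rewrite gen_subG; apply/subsetP=> g; rewrite inE => /andP[]. Qed.

Lemma fix_outside_derangements g :
  g \in G :\: <<derangements G>> -> exists x, g x = x.
Proof.
case/setDP=> Gg; case: (boolP [forall x, g x != x]) => [der | ].
  by rewrite mem_gen // inE Gg der.
by case/forallPn=> x /negPn /eqP; exists x.
Qed.

Lemma index_derangements_lt_block :
  1 < k -> #|G : <<derangements G>>| < k.
Proof.
move=> k_gt1; case: (blockQ) => _ _ cardQ.
have /imsetP[x _ _] := trG.
have cB : #|pblock Q x| = k by apply/cardQ/pblock_mem.
have xB : x \in pblock Q x by rewrite mem_pblock.
have /card_gt0P[y] : 0 < #|pblock Q x :\ x|.
  by move: k_gt1; rewrite -cB (cardsD1 x) xB.
case/setD1P=> neq_yx By.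
have fixP : {in G :\: <<derangements G>>,
    forall g, 0 < #|'Fix_([set: T] | 'P)[g]|}.
  move=> g /fix_outside_derangements[z gz]; apply/card_gt0P; exists z.
  by rewrite setTI; apply/afix1P; rewrite /= apermE.
have := index_le_suborbit derangement_subgroup_sub trG fixP
          (in_setT x) (in_setT y) neq_yx.
(* Elements of [G_x] preserve the block of [x], so the orbit of [y] stays in this block and misses
   [x]. *)
move/leq_ltn_trans; apply; rewrite -cB (cardsD1 x (pblock Q x)) xB ltnS.
apply/subset_leq_card/subsetP=> z /orbitP[g /setIP[Gg /astab1P /= gx] /= <-].
rewrite !apermE in gx *; rewrite !inE -{1}gx (inj_eq perm_inj) neq_yx /=.
by rewrite -{1}gx -pblock_image // -[g y]apermE (mem_setact 'P).
Qed.

Lemma index_derangements_lt_blocks :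
  1 < #|Q| -> #|G : <<derangements G>>| < #|Q|.
Proof.
move=> Q_gt1; have /imsetP[x _ _] := trG.
have Tpos : 0 < #|T| by apply/card_gt0P; exists x.
have QB : pblock Q x \in Q by apply: pblock_mem.
have /card_gt0P[C] : 0 < #|Q :\ pblock Q x|.
  by move: Q_gt1; rewrite (cardsD1 (pblock Q x)) QB.
case/setD1P=> neq_CB QC.
have fixQ : {in G :\: <<derangements G>>, forall g, 0 < #|'Fix_(Q | 'P^*)[g]|}.
  move=> g GDg; have [z gz] := fix_outside_derangements GDg.
  apply/card_gt0P; exists (pblock Q z); rewrite inE pblock_mem //=.
  by apply/afix1P; rewrite pblock_image ?gz //; case/setDP: GDg.
have := index_le_suborbit derangement_subgroup_sub (block_transitive Tpos) fixQ
          QB QC neq_CB.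
move/leq_ltn_trans; apply; rewrite (cardsD1 (pblock Q x) Q) QB ltnS.
apply/subset_leq_card/subsetP=> _ /orbitP[g /setIP[Gg /astab1P gB] <-].
rewrite in_setD1 block_image // andbT -[X in _ != X]gB.
by rewrite (inj_eq (act_inj _ g)).
Qed.

End BlockSystem.

(** Multiplying the strict bounds by [#|Q|] and [k] avoids square roots and deciding which factor is
    smaller. *)
Lemma index_derangements_sqr (T : finType) (G : {group {perm T}}) :
  transitive_imprimitive G -> #|G : <<derangements G>>|%g.+1 ^ 2 <= #|T|.
Proof.
case=> trG [k [Q [/andP[k_gt1 k_ltT] blockQ]]].
have [partQ _ cardQ] := blockQ.
have cT : #|T| = (#|Q| * k)%N by rewrite -cardsT (card_uniform_partition cardQ).
have Q_gt1 : 1 < #|Q|.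
  by move: k_ltT; rewrite cT -{1}[k]mul1n ltn_mul2r => /andP[].
rewrite cT -mulnn leq_mul //.
  exact: (index_derangements_lt_blocks trG blockQ).
exact: (index_derangements_lt_block trG blockQ).
Qed.

(** * The extremal example on the affine plane over [F] *)

Section Homothety.

Variables (F : finFieldType) (T : finType) (f : T -> F * F) (h : F * F -> T).
Hypotheses (fK : cancel f h) (hK : cancel h f).

Local Open Scope group_scope.
Local Open Scope ring_scope.

(* [F * F] is used as a product ring, so [(l, l) * v] is the scalar multiple of
   the vector [v] by [l]; [f] transports the action to [T]. *)
Definition homothety (s : {perm T}) (l : F) (w : F * F) : bool :=
  [forall x, f (s x) == (l, l) * f x + w].

Lemma homothetyP (s : {perm T}) l w :
  reflect (forall x, f (s x) = (l, l) * f x + w) (homothety s l w).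
Proof. exact: 'forall_eqP. Qed.

Lemma homothety1 : homothety 1%g 1 0.
Proof. by apply/homothetyP=> x; rewrite perm1 mul1r addr0. Qed.

Lemma homothetyM s t l m v w :
  homothety s l v -> homothety t m w ->
  homothety (s * t)%g (m * l) ((m, m) * v + w).
Proof.
move=> /homothetyP sE /homothetyP tE; apply/homothetyP=> x.
by rewrite permM tE sE mulrDr mulrA addrA.
Qed.

Lemma homothety_exists l w : l != 0 -> {s | homothety s l w}.
Proof.
move=> l0; pose g x := h ((l, l) * f x + w).
have gK : cancel g (fun x => h ((l^-1, l^-1) * (f x - w))).
  move=> x; rewrite /g hK addrK mulrA.
  have -> : (l^-1, l^-1) * (l, l) = 1 :> F * F by congr (_, _); rewrite /= mulVf.
  by rewrite mul1r fK.
exists (perm (can_inj gK)); apply/homothetyP=> x.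
by rewrite permE /g hK.
Qed.

(** Evaluation at [0] identifies the translation parts, then evaluation at [1] the ratios. *)
Lemma homothety_ratio_inj s l m v w :
  homothety s l v -> homothety s m w -> l = m.
Proof.
move=> /homothetyP sE /homothetyP sE'.
have e y : (l, l) * y + v = (m, m) * y + w by rewrite -(hK y) -sE -sE'.
have vw : v = w by have := e 0; rewrite !mulr0 !add0r.
have := e 1; rewrite vw !mulr1 => /addIr [] //.
Qed.

Definition homothety_set : {set {perm T}} :=
  [set s | [exists l, exists w, (l != 0) && homothety s l w]].

Lemma homothety_setP s :
  reflect (exists l w, l != 0 /\ homothety s l w) (s \in homothety_set).
Proof.
rewrite inE; apply: (iffP existsP) => [[l /existsP[w /andP[]]] | [l [w []]]].
  by exists l, w.
by move=> l0 sP; exists l; apply/existsP; exists w; rewrite l0.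
Qed.

Lemma homothety_group_set : group_set homothety_set.
Proof.
apply/group_setP; split.
  by apply/homothety_setP; exists 1, 0; rewrite oner_neq0 homothety1.
move=> s t /homothety_setP[l [v [l0 sP]]] /homothety_setP[m [w [m0 tP]]].
apply/homothety_setP; exists (m * l), ((m, m) * v + w).
by rewrite mulf_neq0 // homothetyM.
Qed.
Canonical homothety_group := group homothety_group_set.

Definition translation_set : {set {perm T}} :=
  [set s | [exists w, homothety s 1 w]].

Lemma translation_setP s :
  reflect (exists w, homothety s 1 w) (s \in translation_set).
Proof. by rewrite inE; apply: existsP. Qed.

Lemma translation_group_set : group_set translation_set.
Proof.
apply/group_setP; split.
  by apply/translation_setP; exists 0; apply: homothety1.
move=> s t /translation_setP[v sP] /translation_setP[w tP].
by apply/translation_setP; eexists; rewrite -[1]mulr1; apply: homothetyM sP tP.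
Qed.
Canonical translation_group := group translation_group_set.

Lemma derangements_translation :
  <<derangements homothety_group>>%g \subset translation_group.
Proof.
rewrite gen_subG; apply/subsetP=> s; rewrite inE => /andP[].
case/homothety_setP=> l [w [_ sP]] /forallP nofix.
apply/translation_setP; exists w.
have [<- // | l1] := eqVneq l 1.
have l1' : 1 - l != 0 by rewrite subr_eq0 eq_sym.
(* Coordinatewise, [(1 - l)^-1 * a] solves [l * z + a = z]; this yields the fixed point when
   [l != 1]. *)
have fixE a : l * ((1 - l)^-1 * a) + a = (1 - l)^-1 * a.
  by rewrite -{2}[a](mulVKf l1') -mulrDl addrC subrK mul1r.
case/eqP: (nofix (h (((1 - l)^-1, (1 - l)^-1) * w))).
apply: (can_inj fK); rewrite (homothetyP _ _ _ sP) hK.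
by case: w {sP} => w1 w2; congr (_, _); apply: fixE.
Qed.

Lemma homothety_transitive : [transitive homothety_group, on [set: T] | 'P].
Proof.
apply/imsetP; exists (h 0); rewrite ?inE //; apply/esym/setP=> y; rewrite inE.
have [s sP] := homothety_exists (f y) (oner_neq0 F).
apply/orbitP; exists s.
  by apply/homothety_setP; exists 1, (f y); rewrite oner_neq0.
by apply: (can_inj fK); rewrite /= apermE (homothetyP _ _ _ sP) hK mulr0 add0r.
Qed.

(** The blocks are the parallel lines on which the first coordinate is constant. *)
Lemma homothety_blocks :
  block_system homothety_group #|F|
    (preim_partition (fun x => (f x).1) [set: T]).
Proof.
split; first exact: preim_partitionP.
  apply/subsetP=> s /homothety_setP[l [w [l0 sP]]].
  rewrite !inE /=; apply/subsetP=> _ /imsetP[x _ ->]; rewrite inE.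
  apply/imsetP; exists (s x); rewrite ?inE //.
  rewrite setactE; apply/setP=> y; apply/imsetP/idP=> [[z] | ].
    rewrite !inE /= => /eqP xz ->.
    by rewrite apermE !(homothetyP _ _ _ sP) /= xz.
  rewrite !inE /= => xy; exists (s^-1%g y); last by rewrite /= apermE permKV.
  rewrite !inE /=; move: xy; rewrite -{1}[y](permKV s).
  by rewrite !(homothetyP _ _ _ sP) /= (inj_eq (addIr _)) (inj_eq (mulfI l0)).
move=> _ /imsetP[x _ ->].
pose g c := h ((f x).1, c).
have g_inj : injective g by move=> c d /(can_inj hK) [].
rewrite -(card_imset _ g_inj); apply: eq_card => y; rewrite !inE /=.
apply/eqP/imsetP=> [xy | [c _ ->]]; last by rewrite hK.
by exists (f y).2; rewrite // /g xy -surjective_pairing fK.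
Qed.

Lemma homothety_imprimitive : transitive_imprimitive homothety_group.
Proof.
split; first exact: homothety_transitive.
exists #|F|, (preim_partition (fun x => (f x).1) [set: T]).
have cT : #|T| = (#|F| * #|F|)%N.
  by rewrite -card_prod; apply: bij_eq_card; exists h; [apply: fK|].
have F_gt1 : (1 < #|F|)%N by apply: finNzRing_gt1.
split; last exact: homothety_blocks.
by rewrite F_gt1 cT ltn_Pmull // ltnW.
Qed.

Lemma index_homothety_ge :
  (#|F|.-1 <= #|homothety_group : <<derangements homothety_group>>|)%N.
Proof.
(* [d l] is the homothety of ratio [l] centred at the origin; its value [1] at [l = 0] only makes
   [d] total. *)
pose d l : {perm T} := if @idP (l != 0) is ReflectT l0
  then sval (homothety_exists 0 l0) else 1%g.
have dP l : l != 0 -> homothety (d l) l 0.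
  by rewrite /d; case: {-}_ / idP => // l0 _; case: homothety_exists.
pose c l := (<<derangements homothety_group>> :* d l)%g.
have c_inj : {in [set~ 0] &, injective c}.
  move=> l m; rewrite !in_setC1 => l0 m0 /rcoset_eqP; rewrite mem_rcoset.
  move=> /(subsetP derangements_translation) /translation_setP[w wP].
  (* [d l] is a translation times [d m], so it also has ratio [m]. *)
  have := homothetyM wP (dP m m0); rewrite mulgKV mulr1 => lm.
  exact: homothety_ratio_inj (dP l l0) lm.
rewrite -(cardsC1 (0 : F)) -(card_in_imset c_inj).
apply/subset_leq_card/subsetP=> _ /imsetP[l + ->].
rewrite in_setC1 => l0; apply/rcosetsP; exists (d l) => //.
by apply/homothety_setP; exists l, 0; split; last exact: dP.
Qed.

End Homothety.

Theorem theorem1p4 (R : rcfType) :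
  (forall (n : nat) (T : finType) (G : {group {perm T}}),
      #|T| = n ->
      transitive_imprimitive G ->
      ((#|G : derangement_subgroup G|%g%:R : R) <= Num.sqrt (n%:R : R) - 1)%R)
  /\
  (forall n p a : nat,
      prime p -> 1 <= a -> n = p ^ (2 * a) ->
      exists G : {group {perm 'I_n}},
        transitive_imprimitive G /\
        (#|G : derangement_subgroup G|%g%:R : R)%R = (Num.sqrt (n%:R : R) - 1)%R).
Proof.
split=> [n T G cT impG | n p a p_pr a_gt0 n_eq].
  (* Writing the index plus one as the root of its square leaves an inequality between natural
     numbers. *)
  rewrite lerBrDr natr1 -(ger0_norm (ler0n R _)) -sqrtr_sqr.
  by rewrite ler_wsqrtr // -natrX ler_nat -cT index_derangements_sqr.
have [F _ cF] := pPrimePowerField p_pr a_gt0.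
have n_sqr : n = (#|F| ^ 2)%N by rewrite cF n_eq -expnM mulnC.
have cFF : #|{: F * F}| = n by rewrite card_prod n_sqr mulnn.
pose f (i : 'I_n) : F * F := enum_val (cast_ord (esym cFF) i).
pose h (v : F * F) : 'I_n := cast_ord cFF (enum_rank v).
have fK : cancel f h by move=> i; rewrite /f /h enum_valK cast_ordKV.
have hK : cancel h f by move=> v; rewrite /f /h cast_ordK enum_rankK.
have impG := homothety_imprimitive fK hK.
exists (homothety_group f); split=> //.
have index_eq : (#|homothety_group f :
    derangement_subgroup (homothety_group f)|%g.+1 = #|F|)%N.
  (* One inequality is the general bound for this group, with [n] the square of [#|F|]; the other
     counts the cosets of the homotheties. *)
  apply/eqP; rewrite eqn_leq; apply/andP; split.
    by rewrite -leq_sqr -n_sqr -[n in _ <= n]card_ord index_derangements_sqr.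
  have := index_homothety_ge fK hK; rewrite -ltnS.
  exact: leq_trans (leqSpred _).
have -> : Num.sqrt (n%:R : R)%R = (#|F|%:R)%R.
  by rewrite [in LHS]n_sqr natrX sqrtr_sqr ger0_norm ?ler0n.
by rewrite -index_eq -natr1 addrK.
Qed.
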